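(* A pregeometry $G$ has a good representation (by a hypergraph) if and only if $G$ is flat.
   Context: Pregeometries. A pregeometry $G$ on a (possibly infinite) set $M$ is a function $d=d_G$ from the finite subsets of $M$ to $\mathbb{N}=\{0,1,2,\dots\}$ such that $d(\emptyset)=0$, $d(A)\le d(A\cup\{x\})\le d(A)+1$, and $d(A\cup B)+d(A\cap B)\le d(A)+d(B)$. A finite $A$ is independent if $d(A)=|A|$; an arbitrary set is independent if all its finite subsets are; $d(Y)=\sup\{|Y_0|: Y_0\subseteq Y \text{ independent}\}$ for arbitrary $Y$. For finite $A$, $\mathrm{cl}_G(A)=\{x: d(A\cup\{x\})=d(A)\}$, and $\mathrm{cl}_G(Y)=\bigcup\{\mathrm{cl}_G(Y_0): Y_0\subseteq Y\text{ finite}\}$. $Y$ is closed if $\mathrm{cl}_G(Y)=Y$. Flatness. For a finite collection $\Sigma=\{E_1,\dots,E_k\}$ of finite-dimensional closed sets of $G$ let $\Delta_G(\Sigma)=\sum_{\emptyset\ne s\subseteq\{1,\dots,k\}}(-1)^{|s|+1}d_G\left(\bigcap_{i\in s}E_i\right)$. $G$ is flat if $\Delta_G(\Sigma)\ge d_G(\bigcup\Sigma)$ for every such $\Sigma$. Hypergraphs. A hypergraph $\mathcal{A}=(M,R)$ is a set $M$ with a set $R$ of non-empty finite subsets of $M$ (edges). For $P\subseteq M$, $R[P]=\{e\in R: e\subseteq P\}$. For finite $Y\subseteq M$, $\delta_{\mathcal{A}}(Y)=|Y|-|R[Y]|$. For finite $X\subseteq M$, $d_{\mathcal{A}}(X)=\inf\{\delta_{\mathcal{A}}(Y):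 X\subseteq Y\subseteq M,\ Y\text{ finite}\}\in\mathbb{Z}\cup\{-\infty\}$. If $d_{\mathcal{A}}$ is non-negative, it is the dimension function of a pregeometry $G_{\mathcal{A}}$ on $M$. $\mathcal{A}$ is a representation of $G$ if $d_{\mathcal A}$ is non-negative and $G_{\mathcal{A}}=G$; it is a good representation of $G$ if moreover $d_{\mathcal{A}}(e)=|e|-1$ for every $e\in R$. *)

(* Defs.v *)
(* MathComp, with finmap and MathComp-Analysis' classical layer *)
From HB Require Import structures.
From mathcomp Require Import all_boot all_order all_algebra.
From mathcomp Require Import finmap.
From mathcomp Require Import boolp classical_sets functions cardinality.
From mathcomp Require Import constructive_ereal.

Set Implicit Arguments.
Unset Strict Implicit.
Unset Printing Implicit Defensive.

Import Order.TTheory GRing.Theory Num.Theory.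
Local Open Scope fset_scope.
Local Open Scope classical_set_scope.
Local Open Scope ring_scope.

Record pregeometry (M : choiceType) := Pregeometry {
  rk :> {fset M} -> nat;
  rk0 : rk fset0 = 0%N;
  rkS : forall (A : {fset M}) (x : M),
    (rk A <= rk (x |` A)%fset)%N /\ (rk (x |` A)%fset <= rk A + 1)%N;
  rk_submod : forall A B : {fset M},
    (rk (A `|` B)%fset + rk (A `&` B)%fset <= rk A + rk B)%N
}.

Definition indep (M : choiceType) (G : pregeometry M) (Y : set M) : Prop :=
  forall A : {fset M}, [set` A] `<=` Y -> G A = #|` A|.

Definition ecard (M : choiceType) (Y : set M) : \bar int :=
  if `[< finite_set Y >] then (#|` fset_set Y|%:Z)%:E else +oo%E.

(* The default value 0 of the supremum is never used: set0 is independent. *)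
Definition setdim (M : choiceType) (G : pregeometry M) (Y : set M) : \bar int :=
  supremum 0%E [set ecard Y0 | Y0 in [set Y0 | Y0 `<=` Y /\ indep G Y0]].

Definition fin_dim (M : choiceType) (G : pregeometry M) (Y : set M) : Prop :=
  setdim G Y \is a fin_num.

Definition fcl (M : choiceType) (G : pregeometry M) (A : {fset M}) : set M :=
  [set x | G (x |` A)%fset = G A].

Definition cl (M : choiceType) (G : pregeometry M) (Y : set M) : set M :=
  \bigcup_(A in [set A : {fset M} | [set` A] `<=` Y]) fcl G A.

Definition is_closed (M : choiceType) (G : pregeometry M) (Y : set M) : Prop :=
  cl G Y = Y.

(* [fine] loses nothing here when the E i are finite-dimensional, since the
   intersections are then finite-dimensional too. *)
Definition Delta (M : choiceType) (G : pregeometry M) (k : nat)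
    (E : 'I_k -> set M) : int :=
  \sum_(s : {set 'I_k} | s != finset.set0)
    (-1) ^+ (#|s| + 1) * fine (setdim G (\bigcap_(i in [set` s]) E i)).

(* A finite collection is an indexed family E_0, ..., E_(k-1), possibly with
   repetitions; repeating a member changes neither Delta nor the union. *)
Definition flat (M : choiceType) (G : pregeometry M) : Prop :=
  forall (k : nat) (E : 'I_k -> set M),
    (forall i, is_closed G (E i) /\ fin_dim G (E i)) ->
    (setdim G (\bigcup_(i in [set: 'I_k]) E i) <= (Delta G E)%:E)%E.

Record hypergraph (M : choiceType) := Hypergraph {
  edges : set {fset M};
  edges_neq0 : forall e, edges e -> e != fset0
}.

Definition edges_in (M : choiceType) (H : hypergraph M) (P : {fset M}) :
    {fset {fset M}} :=
  [fset e in fpowerset P | `[< edges H e >]]%fset.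

Definition predim (M : choiceType) (H : hypergraph M) (Y : {fset M}) : int :=
  #|` Y|%:Z - #|` edges_in H Y|%:Z.

(* The infimum is over a nonempty set (it contains predim H X), so the default
   value -oo plays no role. *)
Definition hdim (M : choiceType) (H : hypergraph M) (X : {fset M}) : \bar int :=
  infimum -oo%E
    [set (predim H Y)%:E | Y in [set Y : {fset M} | (X `<=` Y)%fset]].

(* A pregeometry is determined by its values on finite sets, so the second
   clause says that hdim H is the dimension function of G. *)
Definition representation (M : choiceType) (H : hypergraph M)
    (G : pregeometry M) : Prop :=
  (forall X : {fset M}, (0 <= hdim H X)%E) /\
  (forall X : {fset M}, hdim H X = (G X)%:Z%:E).

Definition good_representation (M : choiceType) (H : hypergraph M)
    (G : pregeometry M) : Prop :=
  representation H G /\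
  (forall e, edges H e -> hdim H e = (#|` e|%:Z - 1)%:E).

(* Main.v *)
Require Import Defs.
From mathcomp Require Import all_boot.
From mathcomp Require Import all_order all_algebra finmap.
From mathcomp Require Import boolp classical_sets cardinality.
From mathcomp Require Import constructive_ereal zify.

Set Implicit Arguments.
Unset Strict Implicit.
Unset Printing Implicit Defensive.

Import Order.TTheory GRing.Theory Num.Theory.
Local Open Scope classical_set_scope.
Local Open Scope ring_scope.

(**
Say that a finite set X is tight for a set R of edges if its predimension
delta R X (the number of points minus the number of edges inside X) is at most
its rank in G.  When G is represented by R, or just represented on the closed
sets E_1, ..., E_k, every finite subset of E_i extends to a tight one of the
same closure.  [tight_cover] produces tight finite Z_i spanning the E_i, with
union U, so that U meets every intersection of the E_i in a tight spanning
set.  Predimension counts points and edges, so inclusion-exclusion turns the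
dimensions of the intersections into

  Delta(E_1, ..., E_k) = number of points of U
                         - number of edges in U lying in some E_i.

Represented implies flat.  Choose U so large that it spans the union of the
E_i.  The right-hand side is at least delta R U, hence at least the rank of U.

Flat implies represented.  Edges are added rank by rank, all of them sets of
nullity one.  Suppose that R consists of edges of rank less than n and
represents G on all sets of rank less than n.

- The key point is that delta R Y >= G Y still holds for every finite Y,
  whatever its rank ([flat_delta_ge]).  Take for the E_i the closures of the
  edges inside Y, and U as above with U containing the points of Y in every E_i.
  Since Y already contains a spanning set of each E_i, adding the tight set Z_i
  does not increase the predimension, by submodularity.  After adding U the
  predimension is Delta plus the number of points of Y outside U, and flatness
  says that Delta is at least the rank of U.

- Therefore a set S of edges of rank n and size n + 1 can be chosen maximal for
  the condition that delta (R + S) >= G on all sets of rank at most n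
  ([maximal_layer]).  By maximality each set e of rank n and size n + 1 lies in
  a tight set of rank n: otherwise e could be added.  If B is a basis of a set X
  of rank n, the tight sets obtained for e = B + x, with x in X, all contain
  B and have rank n, so their union is tight, by submodularity again.  Hence
  R + S represents G on all sets of rank at most n
  ([extend_representation]).

An edge added at stage n has n + 1 points, so a finite set only sees finitely
many stages and the union of all stages is a good representation.
*)

(** * Suprema and infima in a total order *)

Lemma supremumE d (T : orderType d) (x0 m : T) (A : set T) :
  A !=set0 -> ubound A m -> lbound (ubound A) m -> supremum x0 A = m.
Proof.
move=> /set0P A0 um lm; rewrite /supremum (negbTE A0).
case: xgetP => [y _ [uy ly]|/(_ m)[]//].
by apply/eqP; rewrite eq_le (ly _ um) (lm _ uy).
Qed.

Lemma infimumE d (T : orderType d) (x0 m : T) (A : set T) :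
  A m -> lbound A m -> infimum x0 A = m.
Proof.
move=> Am lm; rewrite /infimum; case: eqP => [A0|_]; first by rewrite A0 in Am.
case: xgetP => [y _ [uy ly]|/(_ m)[]]; last by split=> // y; apply.
by apply/eqP; rewrite eq_le (uy _ Am) (ly _ lm).
Qed.

(** * Rank, span and closure in a pregeometry *)

Section Pregeometry.
Variables (M : choiceType) (G : pregeometry M).
Implicit Types (A B X Y : {fset M}) (E F : set M).

Lemma rk_fsetU_bounds A B :
  (G A <= G (A `|` B)%fset <= G A + #|` B|)%N.
Proof.
elim/fset1U_rect: B => [|x B xB IH]; first by rewrite fsetU0 cardfs0; lia.
rewrite fsetUCA cardfsU1 xB.
by have [] := rkS G (A `|` B)%fset x; lia.
Qed.

Lemma rk_mono A B : (A `<=` B)%fset -> (G A <= G B)%N.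
Proof.
by move/fsetUidPr => AB; case/andP: (rk_fsetU_bounds A B); rewrite AB.
Qed.

Lemma rk_le_card A : (G A <= #|` A|)%N.
Proof. by have := rk_fsetU_bounds fset0 A; rewrite fset0U rk0; lia. Qed.

Lemma fcl_sub A : [set` A] `<=` fcl G A.
Proof. by move=> x xA; rewrite /fcl /= (fsetUidPr _ _ _) ?fsub1set //. Qed.

Lemma fclP A x : fcl G A x <-> (G (x |` A)%fset <= G A)%N.
Proof.
split; first by move=> /= ->.
by move=> h; apply/eqP; rewrite eqn_leq h; case: (rkS G A x).
Qed.

Lemma fcl_mono A B : (A `<=` B)%fset -> fcl G A `<=` fcl G B.
Proof.
move=> AB x /fclP xA; apply/fclP.
have := rk_submod G (x |` A)%fset B.
rewrite -fsetUA (fsetUidPr _ _ AB) => h.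
suff : (G A <= G ((x |` A) `&` B)%fset)%N by lia.
by apply: rk_mono; rewrite fsubsetI AB fsubsetUr.
Qed.

Lemma rk_fsetU_fcl A B : [set` B] `<=` fcl G A -> G (A `|` B)%fset = G A.
Proof.
elim/fset1U_rect: B => [|x B xB IH] sB; first by rewrite fsetU0.
rewrite fsetUCA -[RHS]IH; last first.
  by move=> y yB; apply: sB; rewrite /= !inE yB orbT.
have xA : fcl G A x by apply: sB; rewrite /= !inE eqxx.
by apply: (fcl_mono _ xA); apply: fsubsetUl.
Qed.

Lemma rk_le_fcl A B : [set` B] `<=` fcl G A -> (G B <= G A)%N.
Proof.
by move=> /rk_fsetU_fcl <-; apply: rk_mono; apply: fsubsetUr.
Qed.

Lemma eq_rk_sub_fcl A B :
  (A `<=` B)%fset -> (G B <= G A)%N -> [set` B] `<=` fcl G A.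
Proof.
move=> AB h x xB; apply/fclP; apply: leq_trans h; apply: rk_mono.
by rewrite fsubUset AB andbT fsub1set.
Qed.

Lemma cl_fset A : cl G [set` A] = fcl G A.
Proof.
apply/seteqP; split => [x [B /= BA]|x xA]; last by exists A.
by apply: fcl_mono; apply/fsubsetP => y; apply: BA.
Qed.

Lemma fcl_closed A : is_closed G (fcl G A).
Proof.
apply/seteqP; split => [x [B /= BA xB]|x xA]; last first.
  by exists [fset x]%fset; [move=> y /=; rewrite inE => /eqP ->|
    apply: fcl_sub; rewrite /= inE].
apply/fclP; rewrite -(rk_fsetU_fcl BA).
have /fclP h := fcl_mono (fsubsetUr A B) xB.
by apply: leq_trans h; apply: rk_mono; rewrite fsetUS // fsubsetUl.
Qed.

Lemma closed_fcl_sub E A : is_closed G E -> [set` A] `<=` E -> fcl G A `<=` E.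
Proof. by move=> clE AE x xA; rewrite -clE; exists A. Qed.

Lemma closed_bigcap (I : Type) (P : set I) (E : I -> set M) :
  (forall i, is_closed G (E i)) -> is_closed G (\bigcap_(i in P) E i).
Proof.
move=> clE; apply/seteqP; split => [x [B /= BE xB] i Pi|x xE].
  by apply: (closed_fcl_sub (clE i)) xB => y /BE; apply.
exists [fset x]%fset; first by move=> y /=; rewrite inE => /eqP ->.
by apply: fcl_sub; rewrite /= inE.
Qed.

(** Induction on A: a point outside the closure of the current set raises the
    rank by exactly one, and a point inside it changes nothing. *)
Lemma rk_basis A : exists B, [/\ (B `<=` A)%fset, G B = #|` B| & G B = G A].
Proof.
elim/fset1U_rect: A => [|x A xA [B [BA iB gB]]].
  by exists fset0; rewrite fsubset_refl rk0 cardfs0.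
have [h|h] := pselect (fcl G A x).
  exists B; split=> //; last by rewrite gB h.
  by apply: fsubset_trans BA _; apply: fsubsetUr.
have xB : x \notin B by apply: contra xA => /(fsubsetP BA).
have AB : [set` A] `<=` fcl G B by apply: eq_rk_sub_fcl => //; rewrite gB.
have hA : G (x |` A)%fset = (G A).+1.
  by case: (rkS G A x) => h1 h2; move/fclP: h; lia.
exists (x |` B)%fset; split; first by rewrite fsetUS.
  apply/eqP; rewrite eqn_leq rk_le_card cardfsU1 xB -iB gB add1n -hA.
  apply: rk_le_fcl => y /=; rewrite !inE => /orP[/eqP ->|yA].
    by apply: fcl_sub; rewrite /= !inE eqxx.
  by apply: (fcl_mono (fsubsetUr _ B)); apply: AB.
apply/eqP; rewrite eqn_leq rk_mono ?fsetUS //=.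
apply: rk_le_fcl => y /=; rewrite !inE => /orP[/eqP ->|yA].
  by apply: fcl_sub; rewrite /= !inE eqxx.
by apply: (fcl_mono (fsubsetUr _ B)); apply: AB.
Qed.

Lemma indep_fset B : G B = #|` B| -> indep G [set` B].
Proof.
move=> iB A AB; have {}AB : (A `<=` B)%fset by apply/fsubsetP => x; apply: AB.
apply/eqP; rewrite eqn_leq rk_le_card.
have := rk_fsetU_bounds A (B `\` A)%fset.
rewrite fsetUDl fsetDv fsetD0 (fsetUidPr _ _ AB) iB (cardfsDS AB).
by have := fsubset_leq_card AB; lia.
Qed.

Definition spans A E := [set` A] `<=` E /\ E `<=` fcl G A.

Lemma spans_fcl A : spans A (fcl G A).
Proof. by split=> //; apply: fcl_sub. Qed.

(** Otherwise each finite subset of E would leave out of its closure some point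
    of E, and adding such points one by one would make the rank unbounded. *)
Lemma bounded_rk_spans E N :
  (forall B, [set` B] `<=` E -> (G B <= N)%N) -> exists A, spans A E.
Proof.
move=> bE; apply: contrapT => nsp.
suff /(_ N.+1)[A AE] : forall n, exists2 A, [set` A] `<=` E & (n <= G A)%N.
  by have := bE _ AE; lia.
elim=> [|n [A AE nA]]; first by exists fset0.
have /existsNP[x /not_implyP[xE xA]] : ~ E `<=` fcl G A.
  by move=> h; apply: nsp; exists A.
exists (x |` A)%fset.
  by move=> y /=; rewrite !inE => /orP[/eqP ->|/AE].
by case: (rkS G A x) => h1 h2; move/fclP: xA; lia.
Qed.

Lemma ecard_fset A : ecard [set` A] = (#|` A|%:Z)%:E.
Proof. by rewrite /ecard asboolT ?set_fsetK. Qed.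

(** The supremum is attained by a basis of A.  An infinite independent subset of
    E is excluded because its finite subsets have rank at most that of A. *)
Lemma setdim_spans A E : spans A E -> setdim G E = ((G A)%:Z)%:E.
Proof.
move=> [AE EA]; have [B [BA iB gB]] := rk_basis A.
have BE : [set` B] `<=` E by move=> x xB; apply: AE; apply: (fsubsetP BA).
have memB : [set ecard Y0 | Y0 in [set Y0 | Y0 `<=` E /\ indep G Y0]]
    ((G A)%:Z)%:E.
  exists [set` B]; last by rewrite ecard_fset -gB iB.
  by split=> //; apply: indep_fset.
apply: supremumE; first by eexists; exact: memB.
  move=> _ [Y [YE iY] <-].
  have bY C : [set` C] `<=` Y -> (#|` C| <= G A)%N.
    move=> CY; rewrite -(iY _ CY); apply: rk_le_fcl => x /CY /YE; exact: EA.
  have [finY|infY] := pselect (finite_set Y).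
    rewrite /ecard asboolT // lee_fin lez_nat; apply: bY => x.
    by rewrite /= in_fset_set // inE.
  have [C CY] := infinite_set_fset (G A).+1 infY.
  by have := bY _ CY; lia.
by move=> y /(_ _ memB).
Qed.

(** If no finite set spans E, then E has independent subsets of arbitrarily large
    size, and in the extended integers their supremum is +oo. *)
Lemma fin_dim_spans E : fin_dim G E -> exists A, spans A E.
Proof.
move=> fE; apply: contrapT => nsp; move: fE; rewrite /fin_dim.
suff -> : setdim G E = +oo%E by [].
have big N : exists2 B, [set` B] `<=` E & (N < G B)%N.
  apply: contrapT => h; apply: nsp; apply: (@bounded_rk_spans _ N) => B BE.
  by rewrite leqNgt; apply/negP => NB; apply: h; exists B.
apply: supremumE.
- exists (ecard [set` (fset0 : {fset M})]), [set` fset0] => //; split=> //.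
  by apply: indep_fset; rewrite rk0 cardfs0.
- by move=> y _; rewrite leey.
move=> y uy; suff h N : ((N%:Z)%:E <= y)%E.
  case: y uy h => [z uy h| |_ /(_ 0%N)] //.
  by have := h `|z|.+1%N; rewrite lee_fin; lia.
have [A AE NA] := big N; have [B [BA iB gB]] := rk_basis A.
apply: (@le_trans _ _ (ecard [set` B])).
  by rewrite ecard_fset lee_fin; lia.
apply: uy; exists [set` B] => //; split; last exact: indep_fset.
by move=> x xB; apply: AE; apply: (fsubsetP BA).
Qed.

End Pregeometry.

(** * Inclusion-exclusion over subsets of a finite index set *)

(** Expand the product over i of 1 - P i, which is 1 minus the left-hand side; the
    term of the empty subset is the 1. *)
Lemma exists_incl_excl k (P : pred 'I_k) :
  ([exists i, P i] : nat)%:Z =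
  \sum_(s : {set 'I_k} | s != finset.set0)
    (-1) ^+ (#|s| + 1) * ([forall i in s, P i] : nat)%:Z.
Proof.
have termE (s : {set 'I_k}) : \prod_i (if i \in s then - (P i : nat)%:Z else 1)
    = (-1) ^+ #|s| * ([forall i in s, P i] : nat)%:Z.
  rewrite -big_mkcond /= prodrN; congr (_ * _).
  case: forall_inP => [Ps|/forall_inP].
    by rewrite big1 // => i /Ps ->.
  rewrite negb_forall_in => /exists_inP[i si /negbTE Pi].
  by rewrite (bigD1 i) //= Pi mul0r.
have : \prod_i (- (P i : nat)%:Z + 1) = \sum_(s : {set 'I_k})
    \prod_i (if i \in s then - (P i : nat)%:Z else 1) by rewrite bigA_distr.
rewrite [RHS](bigD1 finset.set0) //= [X in _ = X + _]big1 => [|i _]; last first.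
  by rewrite finset.in_set0.
under [in RHS]eq_bigr do rewrite termE.
move=> e; under eq_bigr do rewrite addn1 exprS mulN1r mulNr.
rewrite sumrN; set S := \sum_(_ | _) _ in e *; move: e; case: existsP => [[i Pi]|nP].
  rewrite (bigD1 i) //= Pi mul0r. lia.
rewrite big1 => [|i _]; first by lia.
by have /negP/negbTE -> : ~ P i by move=> Pi; apply: nP; exists i.
Qed.

Lemma in_fset_sep (T : choiceType) (X : {fset T}) (q : pred T) x :
  (x \in [fset y in X | q y]%fset) = (x \in X) && q x.
Proof. by rewrite !inE. Qed.

Lemma card_incl_excl (T : choiceType) k (X : {fset T}) (p : 'I_k -> pred T) :
  #|` [fset x in X | [exists i, p i x]]%fset|%:Z =
  \sum_(s : {set 'I_k} | s != finset.set0)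
    (-1) ^+ (#|s| + 1) * #|` [fset x in X | [forall i in s, p i x]]%fset|%:Z.
Proof.
have cardU1 (q : pred T) x (Y : {fset T}) : x \notin Y ->
    #|` [fset y in (x |` Y)%fset | q y]%fset|%:Z =
    (q x : nat)%:Z + #|` [fset y in Y | q y]%fset|%:Z.
  move=> xY; have [qx|nqx] := boolP (q x).
    have -> : [fset y in (x |` Y)%fset | q y]%fset =
        (x |` [fset y in Y | q y])%fset.
      by apply/fsetP => y; rewrite !inE; case: eqP => // ->; rewrite qx.
    by rewrite cardfsU1 !inE (negbTE xY).
  congr (#|` _|%:Z); apply/fsetP => y; rewrite !inE.
  by case: eqP => // ->; rewrite (negbTE nqx) !andbF.
elim/fset1U_rect: X => [|x X xX IH].
  have z (q : pred T) : #|` [fset x in fset0 | q x]%fset| = 0%N.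
    by apply/eqP; rewrite cardfs_eq0; apply/eqP/fsetP => y; rewrite !inE.
  by rewrite z big1 // => s _; rewrite z mulr0.
rewrite (cardU1 (fun y => [exists i, p i y])) // IH exists_incl_excl -big_split /=.
apply: eq_bigr => s _; rewrite -mulrDr; congr (_ * _).
by rewrite -(cardU1 (fun y => [forall i in s, p i y])).
Qed.

(** * Predimension of a set of edges *)

Section Predimension.
Variable M : choiceType.
Implicit Types (A B P T X Y Z : {fset M}) (E F : set M) (R S : set {fset M}).

Definition trace X E : {fset M} := [fset x in X | x \in E]%fset.

Lemma in_trace X E x : (x \in trace X E) = (x \in X) && (x \in E).
Proof. by rewrite !inE. Qed.

Lemma traceP X E x : x \in trace X E <-> x \in X /\ E x.
Proof.
rewrite in_trace; split; first by case/andP => -> /set_mem.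
by case=> -> /mem_set ->.
Qed.

(** The edges form a bare set rather than a hypergraph because the construction
    below enlarges and restricts it freely. *)
Definition edges_of R X : {fset {fset M}} :=
  [fset e in fpowerset X | `[< R e >]]%fset.

Lemma edges_ofP R X e : e \in edges_of R X <-> (e `<=` X)%fset /\ R e.
Proof.
rewrite !inE /= fpowersetE; split; first by case/andP => -> /asboolP.
by case=> -> h /=; apply/asboolP.
Qed.

Definition delta R X : int := #|` X|%:Z - #|` edges_of R X|%:Z.

(** An edge inside both A and B is inside their intersection, while the union may
    contain edges that lie in neither A nor B. *)
Lemma delta_submod R A B :
  delta R (A `|` B)%fset + delta R (A `&` B)%fset <= delta R A + delta R B.
Proof.
rewrite /delta; have := cardfsUI A B.
have := cardfsUI (edges_of R A) (edges_of R B).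
have /fsubset_leq_card : (edges_of R A `|` edges_of R B `<=`
    edges_of R (A `|` B)%fset)%fset.
  apply/fsubsetP => e; rewrite inE => /orP[] /edges_ofP[eA Re]; apply/edges_ofP;
    split=> //; apply: fsubset_trans eA _; [exact: fsubsetUl|exact: fsubsetUr].
have -> : (edges_of R A `&` edges_of R B = edges_of R (A `&` B))%fset.
  apply/fsetP => e; apply/idP/idP.
    rewrite inE => /andP[/edges_ofP[eA Re] /edges_ofP[eB _]].
    by apply/edges_ofP; rewrite fsubsetI eA eB.
  move=> /edges_ofP[]; rewrite fsubsetI inE => /andP[eA eB] Re.
  by apply/andP; split; apply/edges_ofP.
lia.
Qed.

(** If Q i has the least predimension among the sets between its intersection with
    P and itself, then adding Q i to any set containing P costs nothing, by
    submodularity.  The hypothesis only gets weaker when P grows, so the Q i can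
    be added one after the other. *)
Lemma delta_absorb R (I : eqType) (r : seq I) (Q : I -> {fset M}) P :
  (forall i T, (P `&` Q i `<=` T)%fset -> (T `<=` Q i)%fset ->
     delta R (Q i) <= delta R T) ->
  delta R (P `|` \bigcup_(i <- r) Q i)%fset <= delta R P.
Proof.
elim: r P => [|a r IH] P h; first by rewrite big_nil fsetU0.
rewrite big_cons fsetUA; apply: (@le_trans _ _ (delta R (P `|` Q a)%fset)).
  apply: IH => i T PT; apply: h; apply: fsubset_trans PT.
  by rewrite fsetSI // fsubsetUl.
have := delta_submod R P (Q a).
have := h a _ (fsubset_refl _) (fsubsetIr _ _).
lia.
Qed.

Lemma eq_delta R S X :
  (forall e, (e `<=` X)%fset -> R e <-> S e) -> delta R X = delta S X.
Proof.
move=> RS; rewrite /delta; congr (_ - #|` _|%:Z); apply/fsetP => e.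
by apply/idP/idP => /edges_ofP[eX] /RS Se; apply/edges_ofP; split=> //; apply: Se.
Qed.

Lemma le_delta R S X : R `<=` S -> delta S X <= delta R X.
Proof.
move=> RS; rewrite /delta.
have /fsubset_leq_card : (edges_of R X `<=` edges_of S X)%fset; last by lia.
by apply/fsubsetP => e /edges_ofP[eX /RS Se]; apply/edges_ofP.
Qed.

End Predimension.

(** * Computing Delta with tight finite sets *)

Section TightCover.
Variables (M : choiceType) (G : pregeometry M) (R : set {fset M}).
Implicit Types (A B T X Y Z : {fset M}) (E F : set M).

Definition tight X : Prop := delta R X <= (G X)%:Z.

(** On a closed F this says that R restricted to F represents G restricted to F:
    the tight extension Y has the rank of X, so it stays inside F. *)
Definition represents_on F : Prop :=
  forall X, [set` X] `<=` F -> (G X)%:Z <= delta R X /\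
    exists Y, [/\ (X `<=` Y)%fset, G Y = G X & tight Y].

(** Let U be a tight extension, inside F, of the trace of Z on F.  The union of Z
    and U spans E, so its predimension is at least that of Z; by submodularity
    the predimension of the trace is then at most that of U. *)
Lemma tight_trace E F Z :
  is_closed G E -> is_closed G F -> F `<=` E -> represents_on E ->
  [set` Z] `<=` E -> E `<=` fcl G Z -> tight Z -> tight (trace Z F).
Proof.
move=> clE clF FE repE ZE EZ tZ.
have sF : [set` trace Z F] `<=` F by move=> x /= /traceP[].
have [|_ [U [TU gU tU]]] := repE (trace Z F); first by move=> x /sF /FE.
have UF : [set` U] `<=` F.
  apply: subset_trans (closed_fcl_sub clF sF).
  by apply: eq_rk_sub_fcl => //; rewrite gU.
have ZU : (Z `&` U = trace Z F)%fset.
  apply/fsetP => x; rewrite !inE; apply/andP/andP => -[xZ xU]; split=> //.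
    exact/mem_set/UF.
  by apply: (fsubsetP TU); rewrite in_trace xZ.
have ZUE : (G (Z `|` U)%fset)%:Z <= delta R (Z `|` U)%fset.
  by apply: (repE _ _).1 => x /=; rewrite inE => /orP[/ZE|/UF/FE].
have := delta_submod R Z U; rewrite ZU.
have := rk_mono G (fsubsetUl Z U).
by move: tZ tU; rewrite /tight gU; lia.
Qed.

Definition edges_inside k (E : 'I_k -> set M) : set {fset M} :=
  [set e | R e /\ exists i, [set` e] `<=` E i].

Definition meet k (E : 'I_k -> set M) (s : {set 'I_k}) : set M :=
  \bigcap_(i in [set` s]) E i.

(** Inclusion-exclusion for the points of X and for the edges in X separately: an
    edge lies in the intersection of some E i exactly when it lies in each. *)
Lemma delta_incl_excl k (E : 'I_k -> set M) X :
  (forall x, x \in X -> exists i, E i x) ->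
  delta (edges_inside E) X =
  \sum_(s : {set 'I_k} | s != finset.set0)
    (-1) ^+ (#|s| + 1) * delta R (trace X (meet E s)).
Proof.
move=> XE; pose p i := [pred x | x \in E i].
pose q i := [pred e : {fset M} | `[< [set` e] `<=` E i >]].
have -> : delta (edges_inside E) X =
    #|` [fset x in X | [exists i, p i x]]%fset|%:Z -
    #|` [fset e in edges_of R X | [exists i, q i e]]%fset|%:Z.
  rewrite /delta; congr (Posz _ - Posz _); congr #|` _|; apply/fsetP => a.
    rewrite [in RHS]in_fset_sep; have [aX|//] := boolP (a \in X).
    by have [i ai] := XE _ aX; symmetry; apply/existsP; exists i; apply/mem_set.
  rewrite [in RHS]in_fset_sep; apply/idP/andP.
    move=> /edges_ofP[aX [Ra [i ai]]]; split; first exact/edges_ofP.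
    by apply/existsP; exists i; apply/asboolP.
  move=> [/edges_ofP[aX Ra] /existsP[i /asboolP ai]].
  by apply/edges_ofP; split=> //; split=> //; exists i.
rewrite !card_incl_excl -sumrB; apply: eq_bigr => s _; rewrite -mulrBr.
congr (_ * (Posz _ - Posz _)); congr #|` _|; apply/fsetP => a.
  rewrite in_trace [in LHS]in_fset_sep; congr (_ && _).
  apply/forall_inP/idP => [h|/set_mem h i si]; last exact/mem_set/h.
  by apply/mem_set => i si; apply/set_mem/h.
rewrite [in LHS]in_fset_sep; apply/andP/idP.
  move=> [/edges_ofP[aX Ra] /forall_inP h]; apply/edges_ofP; split=> //.
  apply/fsubsetP => x xa; apply/traceP; split; first exact: (fsubsetP aX).
  by move=> i /= /h /asboolP; apply.
move=> /edges_ofP[aX Ra]; split.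
  apply/edges_ofP; split=> //; apply: fsubset_trans aX _.
  by apply/fsubsetP => x /traceP[].
apply/forall_inP => i si; apply/asboolP => x xa.
by have /traceP[_] := fsubsetP aX _ xa; apply.
Qed.

(** The union U of the Z i must be tight not only on each E i but on every
    intersection of them.  Include in V a finite spanning set W s of every
    intersection, and let Z i be a tight extension of the trace of V on E i.  On
    the intersection indexed by s, the set U is the union of the traces of the
    Z j.  Each trace is tight by [tight_trace].  Fix i in s: thanks to W, the
    traces of Z i and Z j meet in a spanning set of the intersection indexed by s
    and j, so the trace of Z j is absorbed by that of Z i. *)
Lemma tight_cover k (E : 'I_k -> set M) X :
  (forall i, is_closed G (E i)) -> (forall i, fin_dim G (E i)) ->
  (forall i, represents_on (E i)) ->
  exists Z : 'I_k -> {fset M},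
   [/\ forall i, [set` Z i] `<=` E i, forall i, (trace X (E i) `<=` Z i)%fset,
     forall i, tight (Z i) &
     delta (edges_inside E) (\bigcup_(i <- enum 'I_k) Z i)%fset = Delta G E].
Proof.
move=> clE fdE repE.
have meet_sub (s : {set 'I_k}) i : i \in s -> meet E s `<=` E i.
  by move=> si x; apply.
have spanW (s : {set 'I_k}) : exists W, s != finset.set0 -> spans G W (meet E s).
  have [->|[i si]] := finset.set_0Vmem s; first by exists fset0; rewrite eqxx.
  have [A [_ EA]] := fin_dim_spans (fdE i).
  have [W hW] : exists W, spans G W (meet E s).
    apply: (@bounded_rk_spans _ _ _ (G A)) => B BE; apply: rk_le_fcl => x xB.
    by apply: EA; apply: (meet_sub s) => //; apply: BE.
  by exists W.
have {spanW}[W hW] := boolp.choice spanW.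
pose V := (X `|` \bigcup_(s <- enum {: {set 'I_k}}) W s)%fset.
have WV (s : {set 'I_k}) : (W s `<=` V)%fset.
  apply: fsubset_trans (fsubsetUr _ _); apply: (bigfcup_sup _ (j := s)) => //.
  by rewrite mem_enum.
have exZ i : exists Z, [/\ (trace V (E i) `<=` Z)%fset, [set` Z] `<=` E i,
    E i `<=` fcl G Z & tight Z].
  have VE : [set` trace V (E i)] `<=` E i by move=> x /= /traceP[].
  have [_ [Z [VZ gZ tZ]]] := repE i _ VE.
  have ZV : [set` Z] `<=` fcl G (trace V (E i)).
    by apply: eq_rk_sub_fcl => //; rewrite gZ.
  exists Z; split=> //; first exact: subset_trans ZV (closed_fcl_sub (clE i) VE).
  have [|WE EW] := hW (finset.set1 i).
    by apply/finset.set0Pn; exists i; rewrite finset.set11.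
  move=> x xE; apply: (@fcl_mono _ _ (W (finset.set1 i))).
    apply: fsubset_trans VZ; apply/fsubsetP => y yW; apply/traceP; split.
      exact: (fsubsetP (WV _) _ yW).
    by apply: (meet_sub [set i]%SET _ _ _ (WE _ yW)); rewrite finset.set11.
  by apply: EW => j /=; rewrite finset.in_set1 => /eqP ->.
have {exZ}[Z hZ] := boolp.choice exZ.
have WZ (s : {set 'I_k}) i : i \in s -> (W s `<=` Z i)%fset.
  move=> si; have [VZ _ _ _] := hZ i; apply: fsubset_trans VZ.
  have [|WE _] := hW s; first by apply/finset.set0Pn; exists i.
  apply/fsubsetP => y yW; apply/traceP; split; first exact: (fsubsetP (WV s)).
  by apply: (meet_sub s) => //; apply: WE.
have clmeet (s : {set 'I_k}) : is_closed G (meet E s) by apply: closed_bigcap.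
pose U := (\bigcup_(i <- enum 'I_k) Z i)%fset.
have ZU i : (Z i `<=` U)%fset.
  by apply: (bigfcup_sup _ (j := i)) => //; rewrite mem_enum.
exists Z; split; try by move=> i; have [] := hZ i.
  move=> i; have [VZ _ _ _] := hZ i; apply: fsubset_trans VZ.
  by apply/fsubsetP => x /traceP[xX xE]; apply/traceP; rewrite inE xX.
rewrite -/U delta_incl_excl => [|x /bigfcupP[i _ xi]]; last first.
  by exists i; have [_ ZE _ _] := hZ i; apply: ZE.
apply: eq_bigr => s s0; congr (_ * _).
have [WE EW] := hW s s0; have [i si] := finset.set0Pn _ s0.
have repS : represents_on (meet E s).
  by move=> Y YE; apply: (repE i) => x /YE; apply: meet_sub.
have spU : spans G (trace U (meet E s)) (meet E s).
  split=> [x /= /traceP[] //|x /EW]; apply: fcl_mono; apply/fsubsetP => y yW.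
  apply/traceP; split; last exact: WE.
  by apply: (fsubsetP (ZU i)); apply: (fsubsetP (WZ _ _ si)).
rewrite (setdim_spans spU) /=; apply/eqP; rewrite eq_le.
rewrite (repS _ _).1 ?andbT; last by case: spU.
have -> : trace U (meet E s) =
    (trace (Z i) (meet E s) `|`
      \bigcup_(j <- enum 'I_k) trace (Z j) (meet E s))%fset.
  apply/fsetP => x; apply/idP/idP.
    move=> /traceP[/bigfcupP[j jk xj] xE]; rewrite inE; apply/orP; right.
    by apply/bigfcupP; exists j => //; apply/traceP.
  rewrite inE => /orP[|/bigfcupP[j _]] /traceP[xZ xE]; apply/traceP; split=> //.
    exact: (fsubsetP (ZU i)).
  exact: (fsubsetP (ZU j)).
have tZs j : tight (trace (Z j) (meet E s)).
  (* Z j lies in E j, so adding j to s does not change the trace *)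
  have -> : trace (Z j) (meet E s) = trace (Z j) (meet E (j |: s)%SET).
    apply/fsetP => x; apply/idP/idP => /traceP[xZ xE]; apply/traceP; split=> //.
      move=> l /=; rewrite finset.in_setU1 => /orP[/eqP ->|/xE //].
      by have [_ ZE _ _] := hZ j; apply: ZE.
    by move=> l ls; apply: xE; rewrite /= finset.in_setU1 ls orbT.
  have [_ ZE EZ tZ] := hZ j; apply: (@tight_trace (E j)) => //.
  by apply: meet_sub; rewrite finset.setU11.
apply: le_trans (_ : delta R (trace (Z i) (meet E s)) <= _).
  apply: delta_absorb => j T ijT Tj.
  apply: le_trans (tZs j) _; apply: le_trans (_ : (G T)%:Z <= _).
    have [|WjE EWj] := hW (j |: s)%SET.
      by apply/finset.set0Pn; exists j; rewrite finset.setU11.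
    rewrite lez_nat; apply: leq_trans (_ : G (W (j |: s)%SET) <= _)%N.
      apply: rk_le_fcl => x /= /traceP[xZ xE]; apply: EWj => l /=.
      rewrite finset.in_setU1 => /orP[/eqP ->|/xE //].
      by have [_ ZE _ _] := hZ j; apply: ZE.
    apply: rk_mono; apply: fsubset_trans ijT; apply/fsubsetP => x xW.
    have xE : meet E s x.
      by move=> l ls; apply: (WjE _ xW); rewrite /= finset.in_setU1 ls orbT.
    rewrite inE; apply/andP; split; apply/traceP; split=> //.
      by apply: (fsubsetP (WZ _ _ _) x xW); rewrite finset.in_setU1 si orbT.
    by apply: (fsubsetP (WZ _ _ _) x xW); rewrite finset.setU11.
  by apply: (repS _ _).1 => x /(fsubsetP Tj) /traceP[].
apply: le_trans (tZs i) _; rewrite lez_nat; apply: rk_mono.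
exact: fsubsetUl.
Qed.

End TightCover.

(** * A represented pregeometry is flat *)

(** The predimensions are integers, so an infimum that is finite is attained:
    otherwise n + 1 would still be a lower bound. *)
Lemma hdimP (M : choiceType) (H : hypergraph M) (X : {fset M}) (n : nat) :
  hdim H X = (n%:Z)%:E <->
  (forall Y, (X `<=` Y)%fset -> n%:Z <= delta (edges H) Y) /\
  exists2 Y, (X `<=` Y)%fset & delta (edges H) Y <= n%:Z.
Proof.
split=> [|[lb [Y XY Yn]]]; last first.
  apply: infimumE.
    exists Y => //; congr EFin; have := lb _ XY.
    by rewrite /predim -/(delta _ _); lia.
  by move=> _ [Z XZ <-]; rewrite lee_fin; apply: lb.
rewrite /hdim /infimum; case: eqP => // _.
case: xgetP => // _ -> [lb glb] e; rewrite e in lb glb.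
have {}lb Y : (X `<=` Y)%fset -> n%:Z <= delta (edges H) Y.
  by move=> XY; rewrite -lee_fin; apply: lb; exists Y.
split=> //; apply: contrapT => nY.
suff : ((n%:Z + 1)%:E <= (n%:Z)%:E)%E by rewrite lee_fin; lia.
apply: glb => _ [Y XY <-]; rewrite lee_fin -/(delta (edges H) Y).
have := lb _ XY; have [//|h _] := leP (n%:Z + 1) (delta (edges H) Y).
by case: nY; exists Y => //; lia.
Qed.

Section Flatness.
Variables (M : choiceType) (G : pregeometry M).
Implicit Types (A B T X Y Z e : {fset M}) (E F : set M) (R S : set {fset M}).

(** Apply [tight_cover] with a spanning set A of the union of the E i.  Delta only
    counts the edges inside some E i, so it is at least delta R U, hence at least
    the rank of the superset U of A. *)
Lemma represented_flat R :
  (forall X, (G X)%:Z <= delta R X) ->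
  (forall X, exists2 Y, (X `<=` Y)%fset & delta R Y <= (G X)%:Z) -> flat G.
Proof.
move=> low up k E hE.
have repE F : represents_on G R F.
  move=> X _; split=> //; have [Y XY Yn] := up X; exists Y.
  have := rk_mono G XY; have := low Y; rewrite /tight.
  by split=> //; [apply/eqP; rewrite eqn_leq; lia|lia].
have [B hB] := boolp.choice (fun i => fin_dim_spans (hE i).2).
have [A spA] : exists A, spans G A (\bigcup_(i in [set: 'I_k]) E i).
  apply: (@bounded_rk_spans _ _ _ (G (\bigcup_(i <- enum 'I_k) B i)%fset)).
  move=> C CE; apply: rk_le_fcl => x /CE [i _ /(hB i).2].
  by apply: fcl_mono; apply: bigfcup_sup; rewrite ?mem_enum.
have [Z [_ AZ _ <-]] := tight_cover A (fun i => (hE i).1) (fun i => (hE i).2)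
  (fun i => repE (E i)).
rewrite (setdim_spans spA) lee_fin.
apply: le_trans (_ : delta R (\bigcup_(i <- enum 'I_k) Z i)%fset <= _); last first.
  by apply: le_delta => e [].
apply: le_trans (low _); rewrite lez_nat; apply: rk_mono.
apply/fsubsetP => x xA; have [i _ xi] := spA.1 _ xA.
apply/bigfcupP; exists i; first by rewrite mem_enum.
by apply: (fsubsetP (AZ i)); apply/traceP.
Qed.

(** * A flat pregeometry has a good representation *)

(** Flatness lifts the inequality from sets of rank less than n to all finite
    sets.  The cover is by the closures E i of the edges e i inside Y, and only
    the edges R' inside some E i are kept.  No edge of Y is lost.  The tight sets
    Z i can be added to Y at no cost since Y contains e i, which spans E i.  The
    predimension of the result is Delta plus the number of points of Y outside
    U. *)
Lemma flat_delta_ge n R :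
  flat G -> (forall e, R e -> (G e < n)%N) ->
  (forall F, (forall X, [set` X] `<=` F -> (G X < n)%N) -> represents_on G R F) ->
  forall Y, (G Y)%:Z <= delta R Y.
Proof.
move=> flatG Rn rep Y; set es := enum_fset (edges_of R Y).
pose e (i : 'I_(size es)) := nth fset0 es i; pose E i := fcl G (e i).
have eY i : (e i `<=` Y)%fset /\ R (e i).
  by apply/edges_ofP; apply: mem_nth.
have clE i : is_closed G (E i) by apply: fcl_closed.
have fdE i : fin_dim G (E i) by rewrite /fin_dim (setdim_spans (spans_fcl G (e i))).
have repE i : represents_on G R (E i).
  by apply: rep => X /rk_le_fcl h; apply: leq_ltn_trans h (Rn _ (eY i).2).
have [Z [ZE YZ tZ DZ]] := tight_cover Y clE fdE repE.
have [A spA] : exists A, spans G A (\bigcup_(i in [set: 'I_(size es)]) E i).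
  apply: (@bounded_rk_spans _ _ _ (G Y)) => B BE; apply: rk_le_fcl => x /BE [i _].
  exact: (fcl_mono (eY i).1).
have := flatG _ E (fun i => conj (clE i) (fdE i)).
rewrite (setdim_spans spA) lee_fin -DZ.
set R' := edges_inside R E; set U := (\bigcup_(i <- _) Z i)%fset => GA.
have ZU i : (Z i `<=` U)%fset by apply: bigfcup_sup; rewrite ?mem_enum.
have GU : (G U <= G A)%N.
  apply: rk_le_fcl => x /bigfcupP[i _ xi].
  by apply: spA.2; exists i => //; apply: ZE.
have R'E i X : [set` X] `<=` E i -> delta R' X = delta R X.
  move=> XE; apply: eq_delta => a aX; split=> [[]//|Ra]; split=> //.
  by exists i => x xa; apply: XE; apply: (fsubsetP aX).
have R'Y : delta R' Y = delta R Y.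
  apply: eq_delta => a aY; split=> [[]//|Ra]; split=> //.
  have aes : a \in edges_of R Y by apply/edges_ofP.
  have ia : (index a es < size es)%N by rewrite index_mem; exact: aes.
  by exists (Ordinal ia); rewrite /E /e /= nth_index ?index_mem //; apply: fcl_sub.
have YU : delta R' (Y `|` U)%fset <= delta R Y.
  rewrite -R'Y; apply: delta_absorb => i T YT TZ.
  have TE : [set` T] `<=` E i by move=> x /(fsubsetP TZ) /ZE.
  rewrite !(R'E i) //; apply: le_trans (tZ i) _.
  apply: le_trans ((repE i _ TE).1); rewrite lez_nat.
  apply: leq_trans (_ : G (e i) <= _)%N; first exact: rk_le_fcl.
  apply: rk_mono; apply: fsubset_trans YT; apply/fsubsetP => x xe.
  have xY := fsubsetP (eY i).1 _ xe.
  rewrite inE xY; apply: (fsubsetP (YZ i)); apply/traceP; split=> //.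
  exact: fcl_sub.
have edgesU : edges_of R' (Y `|` U)%fset = edges_of R' U.
  apply/fsetP => a; apply/idP/idP => /edges_ofP[aU Ra]; apply/edges_ofP; split=> //.
    case: Ra => _ [i aE]; apply/fsubsetP => x xa.
    have := fsubsetP aU _ xa; rewrite inE => /orP[xY|//].
    apply: (fsubsetP (ZU i)); apply: (fsubsetP (YZ i)); apply/traceP; split=> //.
    exact: aE.
  by apply: fsubset_trans aU _; apply: fsubsetUr.
apply: le_trans YU; move: GA; rewrite /delta edgesU.
have eU : (Y `|` U = U `|` (Y `\` U))%fset.
  by rewrite fsetUDl fsetDv fsetD0 fsetUC.
have := rk_mono G (fsubsetUl Y U); have := rk_fsetU_bounds G U (Y `\` U)%fset.
rewrite -eU; have := cardfsID U (Y `|` U)%fset.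
rewrite fsetUK fsetDUl fsetDv fsetU0.
lia.
Qed.

Lemma delta_setU1 R e X : delta R X <= delta (R `|` [set e]) X + 1.
Proof.
have /fsubset_leq_card : (edges_of (R `|` [set e]) X `<=` e |` edges_of R X)%fset.
  apply/fsubsetP => a /edges_ofP[aX [Ra|->]]; rewrite inE; apply/orP.
    by right; apply/edges_ofP.
  by left; rewrite inE.
by rewrite /delta; have := cardfsU1 e (edges_of R X); lia.
Qed.

Definition nullity1 n e : Prop := #|` e| = n.+1 /\ G e = n.

(** The alternative that A is empty accounts for the empty chain. *)
Lemma chain_fset_sub (T : choiceType) (C : set (set T)) (A : {fset T}) :
  total_on C subset -> [set` A] `<=` \bigcup_(S in C) S ->
  A = fset0 \/ exists2 S, C S & [set` A] `<=` S.
Proof.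
move=> totC; elim/fset1U_rect: A => [|x A xA IH] AC; first by left.
right; have [|S CS xS] := AC x; first by rewrite /= !inE eqxx.
have [|->|[S' CS' AS']] := IH.
- by move=> y yA; apply: AC; rewrite /= inE yA orbT.
- by exists S => // y /=; rewrite !inE orbF => /eqP ->.
- have [SS|SS] := totC _ _ CS CS'.
    by exists S' => // y /=; rewrite !inE => /orP[/eqP ->|/AS' //]; apply: SS.
  by exists S => // y /=; rewrite !inE => /orP[/eqP -> //|/AS' /SS].
Qed.

Definition admissible n R S : Prop :=
  S `<=` nullity1 n /\
  forall X, (G X <= n)%N -> (G X)%:Z <= delta (R `|` S) X.

(** Zorn's lemma applies because the condition on X involves only the finitely
    many edges inside X.  For e outside the maximal S, some X violates the
    inequality once e is added; the predimension drops by at most one, so X was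
    already tight, and it contains e.  An e in S is tight itself, being one of its own
    edges. *)
Lemma maximal_layer n R :
  (forall X, (G X <= n)%N -> (G X)%:Z <= delta R X) ->
  exists S, admissible n R S /\
    forall e, nullity1 n e -> exists Y,
      [/\ (e `<=` Y)%fset, (G Y <= n)%N & tight G (R `|` S) Y].
Proof.
move=> lowR.
have [C CP totC|S [[Sn lowS] maxS]] := @Zorn_bigcup _ (admissible n R).
  split=> [e [S /CP[h _]] /h //|X Xn].
  have [|W0|[S CS WS]] := @chain_fset_sub _ C (edges_of (\bigcup_(S in C) S) X) totC.
  - by move=> e /edges_ofP[].
  - rewrite (@eq_delta _ _ R); first exact: lowR.
    move=> e eX; split=> [[//|eC]|]; last by left.
    have : e \in edges_of (\bigcup_(S in C) S) X by apply/edges_ofP.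
    by rewrite W0.
  - rewrite (@eq_delta _ _ (R `|` S)); first by apply: (CP _ CS).2.
    move=> e eX; split=> [[Re|eC]|[Re|Se]]; [by left| |by left|].
      by right; apply: WS; apply/edges_ofP.
    by right; exists S.
exists S; split=> // e cn; have [en Ge] := cn.
have [Se|nSe] := pselect (S e).
  exists e; split; rewrite ?Ge // /tight /delta en Ge.
  have : (0 < #|` edges_of (R `|` S) e|)%N; last by lia.
  rewrite cardfs_gt0; apply/fset0Pn; exists e; apply/edges_ofP.
  by split=> //; right.
have nadm : ~ admissible n R (S `|` [set e]).
  apply: maxS; split=> [a Sa|h]; first by left.
  by apply: nSe; apply: h; right.
have /existsNP[X /not_implyP[Xn /negP]] :
    ~ (forall X, (G X <= n)%N -> (G X)%:Z <= delta (R `|` (S `|` [set e])) X).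
  by move=> h; apply: nadm; split=> // a [/Sn //|->].
rewrite setUA -ltNge => Xe; exists X; split=> //; last first.
  by rewrite /tight; have := delta_setU1 (R `|` S) e X; lia.
apply: contrapT => neX; have := lowS _ Xn.
rewrite (@eq_delta _ _ (R `|` S `|` [set e])); first by lia.
by move=> a aX; split=> [h|[//|ae]]; [left|rewrite /= ae in aX].
Qed.

Definition partial_representation n R : Prop :=
  (forall e, R e -> (#|` e| <= n)%N /\ #|` e| = (G e).+1) /\
  (forall X, (G X < n)%N -> (G X)%:Z <= delta R X /\
     exists Y, [/\ (X `<=` Y)%fset, G Y = G X & tight G R Y]).

Definition extension n R R' : Prop :=
  [/\ R `<=` R', forall e, R' e -> R e \/ #|` e| = n.+1 &
      partial_representation n.+1 R'].

(** Tight extensions of a set X of rank n: pick a basis B of X and, for each x in X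
    outside B, a tight set of rank n containing B and x.  All of these contain B
    and lie in its closure, so their union is absorbed by B. *)
Lemma extend_representation n R :
  flat G -> partial_representation n R -> exists R', extension n R R'.
Proof.
move=> flatG [Redge Rrep].
have lowR : forall Y, (G Y)%:Z <= delta R Y.
  apply: (@flat_delta_ge n) => // [e /Redge[]|F Fn X /Fn]; [lia|exact: Rrep].
have [S [[Sn lowS] maxS]] := maximal_layer (fun X (_ : (G X <= n)%N) => lowR X).
exists (R `|` S); split; first by move=> e; left.
  by move=> e [Re|/Sn[-> _]]; [left|right].
split=> [e [/Redge[]|/Sn[-> ->]]|X Xn]; [lia|by []|].
split; first by apply: lowS; lia.
have [Xln|nlX] := ltnP (G X) n.
  have [_ [Y [XY gY tY]]] := Rrep _ Xln; exists Y; split=> //.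
  by apply: le_trans tY; apply: le_delta => e; left.
have {nlX}gX : G X = n by lia.
have [B [BX iB gB]] := rk_basis G X.
have exQ x : exists Y, [/\ (B `<=` Y)%fset, x \in X -> x \in Y, G Y = n &
    tight G (R `|` S) Y].
  have [xX|xX] := boolP ((x \in X) && (x \notin B)); last first.
    exists B; split=> //; [|by rewrite gB|].
      by move=> h; move: xX; rewrite h negbK.
    by rewrite /tight /delta iB; lia.
  case/andP: xX => xX xB.
  have cxB : nullity1 n (x |` B)%fset.
    split; first by rewrite cardfsU1 xB -iB gB gX.
    have BxX : (x |` B `<=` X)%fset by rewrite fsubUset fsub1set xX.
    by have := rk_mono G BxX; have := rk_mono G (fsubsetUr [fset x]%fset B); lia.
  have [Y [xBY Yn tY]] := maxS _ cxB; exists Y; split=> //.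
  - by apply: fsubset_trans xBY; apply: fsubsetUr.
  - by move=> _; apply: (fsubsetP xBY); rewrite !inE eqxx.
  - by case: cxB => _ h; apply/eqP; rewrite eqn_leq Yn -{1}h rk_mono.
have {exQ}[Q hQ] := boolp.choice exQ.
exists (B `|` \bigcup_(x <- X) Q x)%fset; split.
- apply/fsubsetP => x xX; rewrite inE; apply/orP; right.
  by apply/bigfcupP; exists x; [rewrite xX|have [_ + _ _] := hQ x; apply].
- rewrite -gB; apply: rk_fsetU_fcl => y /bigfcupP[x _]; move: y.
  have [BQ _ gQ _] := hQ x; apply: eq_rk_sub_fcl => //.
  by rewrite gQ gB gX.
- rewrite /tight; apply: le_trans (_ : delta (R `|` S) B <= _).
    apply: delta_absorb => x T BT TQ; have [BQ _ gQ tQ] := hQ x.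
    apply: le_trans tQ _; rewrite gQ -{1}gX -gB.
    rewrite (fsetIidPl BQ) in BT.
    apply: le_trans (_ : (G T)%:Z <= _); first by rewrite lez_nat rk_mono.
    by apply: lowS; rewrite -gQ rk_mono.
  apply: le_trans (_ : (G B)%:Z <= _); first by rewrite iB /delta; lia.
  by rewrite lez_nat rk_mono // fsubsetUl.
Qed.

Lemma flat_good_representation :
  flat G -> exists H : hypergraph M, good_representation H G.
Proof.
move=> flatG.
have exf (p : nat * set {fset M}) :
    exists R', partial_representation p.1 p.2 -> extension p.1 p.2 R'.
  have [h|h] := pselect (partial_representation p.1 p.2); last by exists set0.
  by have [R' hR'] := extend_representation flatG h; exists R'.
have {exf}[f hf] := boolp.choice exf.
pose st := fix st n := if n is m.+1 then f (m, st m) else set0.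
have part n : partial_representation n (st n).
  elim: n => [|n IH]; first by split.
  by have [] := hf (n, st n) IH.
have ext n : extension n (st n) (st n.+1) by apply: (hf (n, st n)).
have st_mono m n : (m <= n)%N -> st m `<=` st n.
  move=> /subnK <-; elim: (n - m)%N => [//|d IH] e /IH.
  by have [h _ _] := ext (d + m)%N; apply: h.
(* An edge appears at the stage given by its size or never, so the edges inside a
   finite set stabilise. *)
have st_card m n e : st m e -> (#|` e| <= n)%N -> st n e.
  move=> me en; elim: m me => [//|m IH] me.
  have [mn|nm] := leqP m.+1 n; first exact: (st_mono _ _ mn).
  by have [_ h _] := ext m; have [/IH //|] := h _ me; lia.
pose R := \bigcup_(n in [set: nat]) st n.
have Redge e : R e -> #|` e| = (G e).+1 by move=> [n _ /(part n).1[]].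
have R_eq n X : (#|` X| <= n)%N -> delta R X = delta (st n) X.
  move=> Xn; apply: eq_delta => e /fsubset_leq_card eX.
  by split=> [[m _ /st_card]|ne]; [apply; lia|exists n].
have R0 e : R e -> e != fset0.
  by move=> /Redge h; rewrite -cardfs_gt0 h.
pose H := Hypergraph R0.
have HG X : hdim H X = ((G X)%:Z)%:E.
  apply/hdimP; split=> [Y XY|].
    apply: le_trans (_ : (G Y)%:Z <= _); first by rewrite lez_nat rk_mono.
    pose n := (#|` Y| + (G Y).+1)%N.
    rewrite /= (@R_eq n); last by rewrite /n; lia.
    by apply: ((part n).2 _ _).1; rewrite /n; lia.
  have [_ [Y [XY gY tY]]] := (part (G X).+1).2 X (leqnn _).
  exists Y => //; rewrite -gY; apply: le_trans tY; apply: le_delta.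
  by move=> e ne; exists (G X).+1.
exists H; split; first by split=> X; rewrite HG // lee_fin.
by move=> e Re; rewrite HG (Redge e Re); congr EFin; lia.
Qed.

End Flatness.

Theorem theorem2p4p3 (M : choiceType) (G : pregeometry M) :
  (exists H : hypergraph M, good_representation H G) <-> flat G.
Proof.
split=> [[H [[_ HG] _]]|]; last exact: flat_good_representation.
have hX X := (hdimP H X (G X)).1 (HG X).
apply: (@represented_flat _ _ (edges H)) => X; last by case: (hX X).
by apply: (hX X).1.
Qed.
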